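(* Let $B_R\subset\mathbb{R}^n$ be a ball of radius $R>0$, let $f\in C^1(\mathbb{R})$, and let $u$ be a smooth solution of $$\Delta u=f(u),\quad x\in B_R,$$ such that $u=0$ on $\partial B_R$; extend $u$ to be zero outside $B_R$. Then $$\sup_{B_R}|\nabla u|^2\le C\left(\frac{1}{n^2|B_1|^{2/n}}\|f(u)\|_{L^n(B_R)}^2+R\,\big\|\,|\nabla^2u|^2\,\big\|_{L^n(B_R)}\right),$$ where the constant $C$ depends only on $n$ and $R^2\|f'(u)\|_{L^\infty(B_R)}$.
   Context: $B_1$ is the unit ball of $\mathbb{R}^n$, $|B_1|$ its Lebesgue measure, and $|\nabla^2u|^2=\sum_{1\le i,j\le n}u_{x_ix_j}^2$. *)

(* Defs.v *)
From HB Require Import structures.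
From mathcomp Require Import all_boot all_order all_algebra.
From mathcomp Require Import all_classical all_reals all_analysis.

Set Implicit Arguments.
Unset Strict Implicit.
Unset Printing Implicit Defensive.

Import Order.TTheory GRing.Theory Num.Theory.
Import numFieldNormedType.Exports.

Local Open Scope classical_set_scope.
Local Open Scope ring_scope.

Section tuple_measure.
Context {d} {T : measurableType d} {R : realType}.
Variables (n : nat) (m1 : {sigma_finite_measure set T -> \bar R}).
Variable (m2 : {sigma_finite_measure set (n.-tuple T) -> \bar R}).

Definition consT (p : T * n.-tuple T) : n.+1.-tuple T :=
  [the n.+1.-tuple T of p.1 :: p.2].

Lemma measurable_consT : measurable_fun [set: T * n.-tuple T] consT.
Proof. exact: measurable_cons. Qed.

Definition tuple_measureS : set (n.+1.-tuple T) -> \bar R :=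
  pushforward (m1 \x m2)%E consT.

Let tuple_measureS0 : tuple_measureS set0 = 0%E.
Proof. by rewrite /tuple_measureS /pushforward preimage_set0 measure0. Qed.

Let tuple_measureS_ge0 A : (0 <= tuple_measureS A)%E.
Proof. by apply: integral_ge0 => x _; exact: measure_ge0. Qed.

Let tuple_measureS_sigma_additive : semi_sigma_additive tuple_measureS.
Proof.
have mpre A : measurable A -> measurable (consT @^-1` A).
  by move=> mA; rewrite -[X in measurable X]setTI; exact: measurable_consT.
move=> F mF tF mUF; rewrite /tuple_measureS /pushforward preimage_bigcup.
apply: measure_semi_sigma_additive.
- by move=> i; apply: mpre; exact: mF.
- apply/trivIsetP => i j _ _ ij; rewrite -preimage_setI.
  by move/trivIsetP : tF => /(_ _ _ _ _ ij) ->//; rewrite preimage_set0.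
- by rewrite -preimage_bigcup; exact: mpre.
Qed.

HB.instance Definition _ := isMeasure.Build _ _ _ tuple_measureS
  tuple_measureS0 tuple_measureS_ge0 tuple_measureS_sigma_additive.

Let tuple_measureS_sigma_finite : sigma_finite setT tuple_measureS.
Proof.
have /sigma_finiteP[F [FT ndF Foo]] := sigma_finiteT m1.
have /sigma_finiteP[G [GT ndG Goo]] := sigma_finiteT m2.
pose g (t : n.+1.-tuple T) := (thead t, [tuple of behead t]).
have mg : measurable_fun [set: n.+1.-tuple T] g.
  apply/measurable_fun_pair; last exact: measurable_behead.
  exact: measurable_tnth.
have gK p : g (consT p) = p.
  by case: p => x t; rewrite /g /consT /=; congr (_, _); apply/val_inj.
exists (fun k => g @^-1` (F k `*` G k)).
  rewrite -preimage_bigcup; apply/esym; rewrite -subTset => t _ /=.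
  have [i _ Fi] : (\bigcup_i F i) (g t).1 by rewrite -FT.
  have [j _ Gj] : (\bigcup_i G i) (g t).2 by rewrite -GT.
  exists (maxn i j) => //; split.
    by move: Fi; exact/subsetPset/ndF/leq_maxl.
  by move: Gj; exact/subsetPset/ndG/leq_maxr.
move=> k; have [mF Fk] := Foo k; have [mG Gk] := Goo k; split.
  by rewrite -[X in measurable X]setTI; apply: mg => //; exact: measurableX.
rewrite /tuple_measureS /pushforward.
rewrite (_ : consT @^-1` _ = F k `*` G k); last first.
  by rewrite -comp_preimage (_ : g \o consT = id)//; exact/funext/gK.
by rewrite product_measure1E// lte_mul_pinfty// ge0_fin_numE.
Qed.

HB.instance Definition _ :=
  @Measure_isSigmaFinite.Build _ _ _ tuple_measureS tuple_measureS_sigma_finite.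

End tuple_measure.

Section euclidean.
Context {R : realType}.

Fixpoint lebesgue_tuple n :
    {sigma_finite_measure set (n.-tuple (measurableTypeR R)) -> \bar R} :=
  match n with
  | 0 => \d_[tuple]
  | n'.+1 => tuple_measureS lebesgue_measure (lebesgue_tuple n')
  end.

Lemma lebesgue_tuple_box n (A : 'I_n -> set R) :
  (forall i, measurable (A i : set (measurableTypeR R))) ->
  (lebesgue_tuple n [set t | forall i, A i (tnth t i)] =
   \prod_(i < n) lebesgue_measure (A i))%E.
Proof.
elim: n A => [|n IH] A mA.
  rewrite big_ord0 /= diracE mem_set//; by case.
rewrite big_ord_recl -IH; last by move=> i; exact: mA.
rewrite [LHS]/= /tuple_measureS /pushforward.
rewrite (_ : _ @^-1` _ =
    A ord0 `*` [set t : n.-tuple _ | forall i, A (lift ord0 i) (tnth t i)]).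
  rewrite product_measure1E//.
  rewrite (_ : mkset _ =
      \bigcap_(i in [set: 'I_n]) (@tnth n _ ^~ i @^-1` A (lift ord0 i))).
    apply: fin_bigcap_measurable => // i _.
    by rewrite -[X in measurable X]setTI; exact: measurable_tnth.
  by apply/seteqP; split => t /= h i; [move=> _|]; exact: h.
apply/seteqP; split => -[x t] /=.
  move=> h; split; first by have := h ord0.
  by move=> i; have := h (lift ord0 i); rewrite tnthS.
move=> [h0 h] i; case: (unliftP ord0 i) => [j ->|->//].
by rewrite tnthS; exact: h.
Qed.

(* The norm of 'rV[R]_n in the library is the sup norm. *)
Definition enorm n (x : 'rV[R]_n) : R := Num.sqrt (\sum_(i < n) x 0 i ^+ 2).

Definition eball n (x0 : 'rV[R]_n) (r : R) : set 'rV[R]_n :=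
  [set x | enorm (x - x0) < r].

Definition tuple_rV n (t : n.-tuple (measurableTypeR R)) : 'rV[R]_n :=
  \row_i tnth t i.

Definition vol n (D : set 'rV[R]_n) : \bar R :=
  lebesgue_tuple n (@tuple_rV n @^-1` D).

(* L^p(D) norm, as the L^p norm on R^n of the extension by zero *)
Definition LpnormOn n (p : \bar R) (D : set 'rV[R]_n) (g : 'rV[R]_n -> R)
    : \bar R :=
  'N[lebesgue_tuple n]_p [EFin \o (g \_ D) \o @tuple_rV n].

Definition partial n (i : 'I_n) (u : 'rV[R]_n -> R) : 'rV[R]_n -> R :=
  'D_(delta_mx 0 i) u.

Fixpoint Ck n (k : nat) (D : set 'rV[R]_n) (u : 'rV[R]_n -> R) : Prop :=
  (forall x, D x -> {for x, continuous u}) /\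
  match k with
  | 0 => True
  | k'.+1 => forall i : 'I_n,
      (forall x, D x -> derivable u x (delta_mx 0 i)) /\ Ck k' D (partial i u)
  end.

(* Meant for D open. *)
Definition smooth n (D : set 'rV[R]_n) (u : 'rV[R]_n -> R) : Prop :=
  forall k, Ck k D u.

Definition laplacian n (u : 'rV[R]_n -> R) (x : 'rV[R]_n) : R :=
  \sum_(i < n) partial i (partial i u) x.

Definition grad_sq n (u : 'rV[R]_n -> R) (x : 'rV[R]_n) : R :=
  \sum_(i < n) partial i u x ^+ 2.

Definition hess_sq n (u : 'rV[R]_n -> R) (x : 'rV[R]_n) : R :=
  \sum_(i < n) \sum_(j < n) partial j (partial i u) x ^+ 2.

Definition C1 (f : R -> R) : Prop :=
  (forall t, derivable f t 1) /\ continuous (derive1 f).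

End euclidean.

(* Main.v *)
From HB Require Import structures.
Require Import Defs.
From mathcomp Require Import all_boot all_order all_algebra.
From mathcomp Require Import all_classical all_reals all_analysis.
From mathcomp Require Import measurable_realfun ring lra.
Import Order.TTheory GRing.Theory Num.Theory.
Import numFieldNormedType.Exports.
Local Open Scope classical_set_scope.
Local Open Scope ring_scope.

Set Implicit Arguments.
Unset Strict Implicit.
Unset Printing Implicit Defensive.

(** The estimate is Morrey's inequality for the exponent 2n, applied to each
    partial derivative v of u: its oscillation over the ball is at most
    C r^(1/2) times the L^(2n) norm of its gradient.  Since u vanishes on the
    boundary sphere, it has an interior critical point, where v = 0; hence
    |v|^2 <= C r || |D^2 u|^2 ||_(L^n) everywhere, with C depending only on n.

    For Morrey's inequality, let Q be a cube centred at the centre of the ball,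
    and join x to y in Q by s |-> x + s^2 (y - x), 0 <= s <= 1.  Then
    |v y - v x| is at most a multiple of the integral of s |Dv|, and
    s |Dv| <= A (1 + (s |Dv| / A)^(2n)) for all A > 0.  Integrating over y in Q,
    the substitution z = x + s^2 (y - x) has Jacobian s^(2n), which cancels the
    factor s^(2n); it remains to optimise in A. *)

(** * Affine changes of variables *)

Section affine.
Context {R : realType}.
Local Notation mu := (@lebesgue_measure R).

Definition affine (b c : R) : measurableTypeR R -> measurableTypeR R :=
  fun x => b + c * x.

Lemma measurable_affine b c : measurable_fun setT (affine b c).
Proof.
apply: (@measurable_funD _ _ R); first exact: measurable_cst.
by apply: (@measurable_funM _ _ R); [exact: measurable_cst|exact: measurable_id].
Qed.

(** By uniqueness of Lebesgue measure: [c] times its pushforward under [affine b c] gives each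
    half-open interval its length. The formula is then integration against a pushforward. *)
Lemma ge0_integral_affine b c (f : measurableTypeR R -> \bar R) : 0 < c ->
  measurable_fun setT f -> (forall x, 0 <= f x)%E ->
  (c%:E * \int[mu]_x f (affine b c x) = \int[mu]_x f x)%E.
Proof.
move=> c0 mf f0; pose c' := NngNum (ltW c0).
have mA := measurable_affine b c.
pose push : {measure set (measurableTypeR R) -> \bar R} :=
  measure_function_pushforward__canonical__measure_function_Measure mu mA.
have muE A : measurable A -> mu A = mscale c' push A.
  apply: lebesgue_measure_unique => _ [[x y]] _ <-.
  rewrite /= /mscale /= /pushforward.
  have -> : affine b c @^-1` `]x, y] = `](x - b) / c, (y - b) / c]%classic.
    apply/seteqP; split => z /=;
      rewrite !in_itv/= /affine ltr_pdivrMr// ler_pdivlMr//;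
      by rewrite ltrBlDl lerBrDl mulrC.
  rewrite !lebesgue_measure_itv/= !lte_fin ltr_pM2r ?invr_gt0// ltrD2r.
  case: ifPn => _; last by rewrite mule0.
  by rewrite -!EFinB -EFinM; congr EFin; field; rewrite gt_eqF.
rewrite [RHS](@eq_measure_integral _ _ _ _ (mscale c' push)); last first.
  by move=> A mA' _; exact: muE.
by rewrite ge0_integral_mscale//= ge0_integral_pushforward.
Qed.


Definition affine_tuple n (b : n.-tuple R) (c : R)
    (t : n.-tuple (measurableTypeR R)) : n.-tuple (measurableTypeR R) :=
  [tuple affine (tnth b i) c (tnth t i) | i < n].

Lemma measurable_affine_tuple n (b : n.-tuple R) c :
  measurable_fun setT (affine_tuple b c).
Proof.
apply/measurable_fun_tnthP => i.
rewrite (_ : _ \o _ = affine (tnth b i) c \o (fun t => tnth t i)); last first.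
  by apply/funext => t /=; rewrite tnth_mktuple.
by apply: measurableT_comp; [exact: measurable_affine|exact: measurable_tnth].
Qed.

Lemma ge0_integral_lebesgue_tupleS n (f : n.+1.-tuple (measurableTypeR R) -> \bar R) :
  measurable_fun setT f -> (forall x, 0 <= f x)%E ->
  (\int[lebesgue_tuple n.+1]_t f t =
   \int[mu]_x \int[lebesgue_tuple n]_t f (consT (x, t)))%E.
Proof.
move=> mf f0; rewrite /= ge0_integral_pushforward//; last first.
  exact: measurable_consT.
rewrite preimage_setT fubini_tonelli1//.
  by apply: measurableT_comp => //; exact: measurable_consT.
by move=> x; exact: f0.
Qed.

(** Induction on the dimension. Tonelli splits off the first coordinate, whose one-dimensional
    substitution contributes one factor [c]; the induction hypothesis supplies the others. *)
Lemma ge0_integral_affine_tuple n (b : n.-tuple R) c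
    (f : n.-tuple (measurableTypeR R) -> \bar R) : 0 < c ->
  measurable_fun setT f -> (forall x, 0 <= f x)%E ->
  ((c ^+ n)%:E * \int[lebesgue_tuple n]_t f (affine_tuple b c t) =
   \int[lebesgue_tuple n]_t f t)%E.
Proof.
move=> c0; elim: n b f => [|n IH] b f mf f0.
  rewrite expr0 mul1e; apply: eq_integral => t _.
  by rewrite (tuple0 t) (tuple0 (affine_tuple _ _ _)).
have mfb : measurable_fun setT (f \o affine_tuple b c).
  by apply: measurableT_comp => //; exact: measurable_affine_tuple.
have mfc : measurable_fun setT (f \o @consT _ (measurableTypeR R) n).
  by apply: measurableT_comp => //; exact: measurable_consT.
rewrite !ge0_integral_lebesgue_tupleS//.
pose g x := (\int[lebesgue_tuple n]_t f (consT (x, t)))%E.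
have mg : measurable_fun setT g.
  exact: (measurable_fun_fubini_tonelli_F (m2 := lebesgue_tuple n) _ mfc (fun x => f0 _)).
rewrite -[RHS](@ge0_integral_affine (tnth b ord0) c g)//; last first.
  by move=> x; exact: integral_ge0.
rewrite exprS EFinM -muleA; congr (_ * _)%E.
rewrite -ge0_integralZl//; last 3 first.
- exact: (measurable_fun_fubini_tonelli_F (m2 := lebesgue_tuple n) _
    (measurableT_comp mfb (@measurable_consT _ _ _)) (fun x => f0 _)).
- by move=> x _; exact: integral_ge0.
- by rewrite lee_fin exprn_ge0// ltW.
apply: eq_integral => x _.
rewrite /g -(IH [tuple of behead b] (fun t => f (consT (_, t)))); last 2 first.
- exact: (measurableT_comp mfc (pair1_measurable _)).
- by [].
congr (_ * _)%E; apply: eq_integral => t _; congr f.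
apply/eq_from_tnth => i; rewrite tnth_mktuple.
case: (unliftP ord0 i) => [j ->|->]; rewrite ?tnthS ?tnth0//.
rewrite tnth_mktuple tnth_behead; congr (affine (tnth b _) _ _).
by apply/val_inj; rewrite /= inordK ?ltnS.
Qed.

End affine.

(** * Borel measurability on tuples *)

Section measurability.
Context {R : realType} (n : nat).
Local Notation T := (n.-tuple (measurableTypeR R)).

Lemma measurable_box (A : 'I_n -> set (measurableTypeR R)) :
  (forall i, measurable (A i)) ->
  measurable [set t : T | forall i, A i (tnth t i)].
Proof.
move=> mA; rewrite (_ : mkset _ =
    \bigcap_(i in [set: 'I_n]) ((fun t : T => tnth t i) @^-1` A i)).
  apply: fin_bigcap_measurable => // i _.
  by rewrite -[X in measurable X]setTI; apply: measurable_tnth.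
by apply/seteqP; split => t /= h i; [move=> _|]; exact: h.
Qed.

Lemma measurable_tuple_rV_ball (c : 'rV[R]_n) e : 0 < e ->
  measurable (@tuple_rV R n @^-1` ball c e).
Proof.
move=> e0; rewrite (_ : _ @^-1` _ =
    [set t : T | forall i, ball (c 0 i) e (tnth t i)]).
  by apply: (@measurable_box (fun i => ball (c 0 i) e)) => i; exact: measurable_ball.
apply/seteqP; split => t /=; first by move=> [_ h] i; have := h 0 i; rewrite mxE.
by move=> h; split=> // i j; rewrite ord1 mxE; exact: h.
Qed.

(** The measurable sets of tuples are generated by the coordinates, so open sets are reached through
    second countability: [U] is the countable union of the balls with rational centre and radius
    1/(k+1) that it contains, and a sup-norm ball is a box. *)
Lemma open_tuple_rV_measurable (U : set 'rV[R]_n) : open U ->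
  measurable (@tuple_rV R n @^-1` U).
Proof.
move=> oU.
pose c (q : n.-tuple rat) : 'rV[R]_n := \row_i ratr (tnth q i).
pose F (p : n.-tuple rat * nat) : set T :=
  if `[< ball (c p.1) p.2.+1%:R^-1 `<=` U >]
  then @tuple_rV R n @^-1` ball (c p.1) p.2.+1%:R^-1 else set0.
rewrite (_ : _ @^-1` _ = \bigcup_p F p); last first.
  apply/seteqP; split=> t; last first.
    by move=> [p _]; rewrite /F; case: ifPn => // /asboolP; apply.
  rewrite /preimage /= => Ut.
  have [e /= e0 eU] : nbhs_ball (tuple_rV t) U by apply/nbhs_ballP/open_nbhs_nbhs.
  (* With radius below [e / 2], a ball that contains the point lies within distance [e] of it. *)
  have [k k0] : exists k, (k.+1%:R^-1 : R) < e / 2.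
    have e20 : 0 < e / 2 by rewrite divr_gt0.
    have [k _ /(_ k (leqnn k)) ?] := near_infty_natSinv_lt (PosNum e20).
    by exists k.
  have ki0 : 0 < k.+1%:R^-1 :> R by rewrite invr_gt0.
  have /choice[q qP] : forall i : 'I_n, exists q : rat,
      `|ratr q - tnth t i| < k.+1%:R^-1.
    move=> i; have /(@rat_in_itvoo R)[q] :
      tnth t i - k.+1%:R^-1 < tnth t i + k.+1%:R^-1.
      by rewrite ltrD2l gtrN.
    by rewrite in_itv/= => ?; exists q; rewrite ltr_distl.
  have cq : ball (c [tuple q i | i < n]) k.+1%:R^-1 (tuple_rV t).
    by split=> // i j; rewrite ord1 !mxE tnth_mktuple; exact: qP.
  exists ([tuple q i | i < n], k) => //; rewrite /F /=.
  case: ifPn => // /asboolPn[] y cy; apply: eU.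
  apply: (@ball_split _ _ (c [tuple q i | i < n])).
    by apply: ball_sym; apply: le_ball cq; exact: ltW.
  by apply: le_ball cy; exact: ltW.
apply: countable_bigcupT_measurable => // p; rewrite /F; case: ifPn => // _.
by apply: measurable_tuple_rV_ball; rewrite invr_gt0.
Qed.

(** Continuity holds only at points of [D], but [D] is open, so the part of the preimage of an open
    interval that lies in [D] is still open. *)
Lemma continuous_on_open_measurable (D : set 'rV[R]_n) (g : 'rV[R]_n -> R) :
  open D -> (forall x, D x -> {for x, continuous g}) ->
  measurable_fun setT ((g \_ D) \o @tuple_rV R n).
Proof.
move=> oD cg; have mD := open_tuple_rV_measurable oD.
rewrite (_ : _ \o _ = (g \o @tuple_rV R n) \_ (@tuple_rV R n @^-1` D)); last first.
  by apply/funext => t; rewrite /= !patchE.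
apply: (measurable_restrictT _ mD).1.
apply: (measurability _ (RGenOpens.measurableE R)).
move=> _ [_ [a [b ->] <-]].
rewrite (_ : _ `&` _ = @tuple_rV R n @^-1` (D `&` g @^-1` `]a, b[))//.
apply: open_tuple_rV_measurable; rewrite openE => x [Dx gx].
rewrite /interior; apply: filterI; first exact: open_nbhs_nbhs.
by apply: cg => //; apply: open_nbhs_nbhs; split => //; exact: interval_open.
Qed.

End measurability.

(** * Continuous partial derivatives *)

Section calculus.
Context {R : realType}.

Lemma cvg_sum (T I : Type) (F : set_system T) (FF : Filter F) (r : seq I)
    (f : I -> T -> R) (a : I -> R) :
  (forall i, f i x @[x --> F] --> a i) ->
  (\sum_(i <- r) f i x) @[x --> F] --> \sum_(i <- r) a i.
Proof. by move=> fa; apply: (cvg_big (op := +%R)) => //; exact: add_continuous. Qed.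

Lemma is_diff_near_linear (V W : normedModType R) (f : V -> W)
    (df : {linear V -> W}) (x : V) :
  continuous df ->
  (forall e, 0 < e -> \forall w \near 0, `|f (x + w) - f x - df w| <= e * `|w|) ->
  is_diff x f df.
Proof.
move=> cdf fdf.
have E : f \o shift x = cst (f x) + df +o_ 0 id.
  apply/eqaddoP => e e0; apply: filterS (fdf e e0) => w.
  rewrite [X in `|X| <= _ -> _](_ : _ = (f \o shift x - (cst (f x) + df)) w) //=.
  by rewrite ![in RHS]fctE [w + x]addrC opprD addrA.
have dfE := diff_unique cdf E.
by apply: DiffDef => //; apply/diff_locallyP; rewrite dfE.
Qed.

(** Both derivatives are limits of literally the same difference quotient. *)
Lemma is_derive_line (V : normedModType R) (v : V -> R) (y e : V) (h : R) :
  derivable v (y + h *: e) e ->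
  is_derive h 1 (fun s : R => v (y + s *: e)) ('D_e v (y + h *: e)).
Proof.
have E : (fun k : R => k^-1 *: (((fun s : R => v (y + s *: e)) \o shift h) (k *: 1) -
    v (y + h *: e))) =
  (fun k : R => k^-1 *: ((v \o shift (y + h *: e)) (k *: e) - v (y + h *: e))).
  apply/funext => k /=; congr (_ *: (v _ - _)).
  by rewrite [k *: 1]mulr1 scalerDl addrCA.
by move=> dv; split; rewrite /derivable /derive E.
Qed.

(** The mean value theorem turns the left side into |b| |df h - c| for some h between 0 and b. As b
    may have either sign, the theorem is applied on [0, b] or on [b, 0]. *)
Lemma MVT_near_linear (f df : R -> R) (b c e : R) :
  (forall h : R, `|h| <= `|b| -> is_derive h 1 f (df h)) ->
  (forall h : R, `|h| <= `|b| -> `|df h - c| <= e) ->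
  `|f b - f 0 - b * c| <= e * `|b|.
Proof.
move=> fdf dfc.
have cf (i : interval R) : (forall h, h \in i -> `|h| <= `|b|) ->
    {within [set` i], continuous f}.
  move=> ib; apply: derivable_within_continuous => h hi.
  by have [] := fdf h (ib h hi).
have [b0|b0] := leP 0 b.
  have ib h : h \in `[0, b] -> `|h| <= `|b|.
    by rewrite in_itv/= => /andP[? ?]; rewrite !ger0_norm.
  have [//|h hb||h hb ->] := @MVT_segment _ f df 0 b.
  - by apply: fdf; apply: ib; exact: subset_itv_oo_cc hb.
  - exact: cf.
  - by rewrite subr0 mulrC -mulrBr normrM mulrC ler_wpM2r// dfc// ib.
have ib h : h \in `[b, 0] -> `|h| <= `|b|.
  by rewrite in_itv/= => /andP[? ?]; rewrite !ler0_norm ?lerN2// ltW.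
have [|h hb||h hb E] := @MVT_segment _ f df b 0; first exact: ltW.
- by apply: fdf; apply: ib; exact: subset_itv_oo_cc hb.
- exact: cf.
- rewrite (_ : f b - f 0 = df h * b); last first.
    by rewrite -[LHS]opprB E sub0r mulrN opprK.
  by rewrite mulrC -mulrBr normrM mulrC ler_wpM2r// dfc// ib.
Qed.

Variable n : nat.
Implicit Types (x w : 'rV[R]_n) (v : 'rV[R]_n -> R).

Lemma le_coord_norm x i : `|x 0 i| <= `|x|.
Proof.
rewrite [leRHS]/Num.norm/= mx_normrE.
by apply: (le_trans _ (le_bigmax _ _ (0, i))).
Qed.

Lemma norm_le_coord x (a : R) : 0 <= a -> (forall i, `|x 0 i| <= a) -> `|x| <= a.
Proof.
move=> a0 xa; rewrite [leLHS]/Num.norm/= mx_normrE.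
by apply/bigmax_leP; split => // -[j i] _; rewrite ord1; exact: xa.
Qed.

(** As k runs from 0 to n, these are the corners of a staircase from 0 to [w], each stair parallel
    to a coordinate axis. *)
Let trunc k w : 'rV[R]_n := \row_i (if (i < k)%N then w 0 i else 0).

(** In the sup norm the whole staircase stays in the ball of radius |w|, hence where the partial
    derivatives are controlled. *)
Let trunc_norm k w i (h : R) : `|h| <= `|w 0 i| -> (i : nat) = k ->
  `|trunc k w + h *: delta_mx 0 i| <= `|w|.
Proof.
move=> hw ik; apply: norm_le_coord => // j; rewrite !mxE eqxx/=.
have [->|ji] := eqVneq j i.
  by rewrite ik ltnn mulr1 add0r (le_trans hw)// le_coord_norm.
by rewrite mulr0 addr0; case: ifP => _; rewrite ?normr0// le_coord_norm.
Qed.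

(** Telescoping along the staircase: each stair changes one coordinate, and [MVT_near_linear] bounds
    its error by e |w_i|, at most e |w|. *)
Lemma partials_near_linear v x (d e : R) :
  (forall i y, ball x d y -> derivable v y (delta_mx 0 i)) ->
  (forall i y, ball x d y -> `|partial i v y - partial i v x| <= e) ->
  forall w, `|w| < d ->
  `|v (x + w) - v x - \sum_i w 0 i * partial i v x| <= n%:R * e * `|w|.
Proof.
move=> dv ve w wd.
suff H k : (k <= n)%N ->
    `|v (x + trunc k w) - v x - \sum_(i < n | (i < k)%N) w 0 i * partial i v x|
    <= k%:R * e * `|w|.
  have := H n (leqnn n).
  rewrite (_ : trunc n w = w); last by apply/rowP => i; rewrite mxE ltn_ord.
  by rewrite (eq_bigl xpredT)// => i; rewrite ltn_ord.
elim: k => [_|k IH kn].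
  rewrite (_ : trunc 0 w = 0); last by apply/rowP => i; rewrite !mxE.
  by rewrite addr0 subrr big_pred0// subr0 normr0 !mul0r.
pose i := Ordinal kn.
have tS : trunc k.+1 w = trunc k w + w 0 i *: delta_mx 0 i.
  apply/rowP => j; rewrite !mxE eqxx/= -val_eqE /= ltnS leq_eqVlt.
  case: (ltngtP j k) => [_|_|jk]; rewrite ?mulr0 ?addr0//.
  by rewrite mulr1 add0r; congr (w 0 _); exact/val_inj.
rewrite (bigD1 i) ?ltnSn//=.
rewrite (eq_bigl (fun j : 'I_n => (j < k)%N)); last first.
  by move=> j; rewrite ltnS -val_eqE /= andbC -ltn_neqAle.
rewrite -(natr1 k) !mulrDl mul1r.
set S := \sum_(_ < n | _) _.
rewrite (_ : _ - _ - _ = (v (x + trunc k w) - v x - S) +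
   (v (x + trunc k.+1 w) - v (x + trunc k w) - w 0 i * partial i v x)); last by ring.
apply: (le_trans (ler_normD _ _)); apply: lerD; first exact: IH (ltnW kn).
pose y := x + trunc k w.
have yb h : `|h| <= `|w 0 i| -> ball x d (y + h *: delta_mx 0 i).
  move=> hw; rewrite -ball_normE /= /y -addrA opprD addNKr normrN.
  by apply: le_lt_trans wd; exact: trunc_norm.
have := @MVT_near_linear (fun h => v (y + h *: delta_mx 0 i))
   (fun h => partial i v (y + h *: delta_mx 0 i)) (w 0 i) (partial i v x) e.
rewrite scale0r addr0 tS addrA -/y => /(_ _ _)/le_trans; apply.
- by move=> h hw; apply: is_derive_line; apply: dv; exact: yb.
- by move=> h hw; apply: ve; exact: yb.
- rewrite ler_wpM2l// ?le_coord_norm//.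
  (* That [e] is nonnegative follows from [ve] at the centre of the ball. *)
  apply: le_trans (ve i x (ballxx _ (le_lt_trans (normr_ge0 _) wd))).
  by rewrite normr_ge0.
Qed.

Section differentiability.
Variables (D : set 'rV[R]_n) (v : 'rV[R]_n -> R).
Hypothesis oD : open D.
Hypothesis dv : forall i x, D x -> derivable v x (delta_mx 0 i).
Hypothesis cdv : forall i x, D x -> {for x, continuous (partial i v)}.

Let grad x w : R := \sum_i w 0 i * partial i v x.

Let grad_linear x : linear (grad x : 'rV[R]_n -> R).
Proof.
move=> a y z; rewrite /grad scaler_sumr -big_split; apply: eq_bigr => i _.
by rewrite !mxE mulrDl -[in LHS]mulrA.
Qed.

Let glin x : {linear 'rV[R]_n -> R} :=
  HB.pack (grad x : 'rV[R]_n -> R)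
    (GRing.isLinear.Build _ _ _ _ (grad x : 'rV[R]_n -> R) (grad_linear x)).

Let glin_continuous x : continuous (glin x).
Proof.
move=> y; apply: (cvg_sum (nbhs_filter y)) => i; apply: cvgM; last exact: cvg_cst.
exact: coord_continuous.
Qed.

(** Continuity makes the partial derivatives nearly constant close to [x], which is what
    [partials_near_linear] asks for. *)
Lemma is_diff_partials x : D x ->
  is_diff x v (fun w => \sum_i w 0 i * partial i v x).
Proof.
move=> Dx; apply: (@is_diff_near_linear _ _ v (glin x)) => // e e0.
(* The n stairs cost a factor n; dividing by n + 1 absorbs it and is safe for n = 0. *)
pose e' := e / n.+1%:R.
have e'0 : 0 < e' by rewrite divr_gt0.
have : \forall y \near x, D y /\
    forall i, `|partial i v y - partial i v x| <= e'.
  near=> y; split; first by near: y; exact: open_nbhs_nbhs.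
  near: y; apply: filter_forall => i.
  have := @cdv i x Dx; move/cvgrPdist_le => /(_ _ e'0).
  by apply: filterS => y; rewrite distrC.
move=> /nbhs_ballP[d /= d0 dP].
near=> w.
apply: (le_trans (@partials_near_linear v x d e' _ _ w _)).
- by move=> i y /dP[Dy _]; exact: dv.
- by move=> i y /dP[_]; exact.
- near: w; apply: filterS (nbhsx_ballx (0 : 'rV[R]_n) d d0) => w.
  by rewrite -ball_normE /= sub0r normrN.
- rewrite ler_wpM2r// /e' mulrCA; apply: ler_piMr; first exact: ltW.
  by rewrite ler_pdivrMr// mul1r ler_nat.
Unshelve. all: by end_near.
Qed.

End differentiability.

End calculus.

(** * Morrey's inequality *)

Section path.
Context {R : realType}.
Local Notation mu := (@lebesgue_measure R).

(** The fundamental theorem of calculus writes the increment as the integral of [df], and the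
    absolute value moves inside. *)
Lemma abs_increment_le_integral (f df g : R -> R) :
  (forall s : R, s \in `[0, 1] -> is_derive s 1 f (df s)) ->
  {within `[0, 1], continuous df} ->
  measurable_fun (`[0, 1] : set (measurableTypeR R)) g ->
  (forall s : R, s \in `[0, 1] -> `|df s| <= g s) ->
  (`|f 1 - f 0|%:E <= \int[mu]_(s in `[0%R, 1%R]) (g s)%:E)%E.
Proof.
move=> fdf cdf mg dfg.
have mdf : measurable_fun (`[0, 1] : set (measurableTypeR R)) df.
  exact: subspace_continuous_measurable_fun.
have cf : {within `[0, 1], continuous f}.
  by apply: derivable_within_continuous => s /fdf[].
have FTC : (\int[mu]_(s in `[0%R, 1%R]) (df s)%:E = (f 1)%:E - (f 0)%:E)%E.
  apply: (@continuous_FTC2 _ df f) => //.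
    have [_ f0 f1] := (continuous_within_itvP f ltr01).1 cf.
    split => // s s01; have [] // := fdf s (subset_itv_oo_cc s01).
  move=> s s01; rewrite derive1E.
  by have [_ ->] := fdf s (subset_itv_oo_cc s01).
rewrite -abse_EFin EFinB -FTC.
apply: le_trans (le_abse_integral _ _ _) _ => //; first exact/measurable_EFinP.
apply: ge0_le_integral => //.
- by apply: measurableT_comp => //; exact/measurable_EFinP.
- exact/measurable_EFinP.
Qed.

Variables (n : nat) (D : set 'rV[R]_n) (v : 'rV[R]_n -> R).
Hypothesis oD : open D.
Hypothesis dv : forall i x, D x -> derivable v x (delta_mx 0 i).
Hypothesis cdv : forall i x, D x -> {for x, continuous (partial i v)}.

Lemma is_derive_quadratic_path (x w : 'rV[R]_n) (s : R) : D (x + s ^+ 2 *: w) ->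
  is_derive s 1 (fun s : R => v (x + s ^+ 2 *: w))
    (2 * s * \sum_i w 0 i * partial i v (x + s ^+ 2 *: w)).
Proof.
move=> Dxw; have vd := is_diff_partials oD dv cdv Dxw.
pose q (t : R) := t ^+ 2.
have qdv : derivable q s 1 by exact: exprn_derivable.
have qd : differentiable q s by exact/derivable1_diffP.
have qE : 'd q s 1 = 2 * s.
  by rewrite deriv1E// /q exp_derive1 expr1 scale1r.
pose p : R -> 'rV[R]_n := cst x + (fun t => q t *: w).
have pd2 : differentiable (fun t => q t *: w) s by exact: differentiableZl.
have pd : differentiable p s by exact: differentiableD.
have pE : 'd p s 1 = (2 * s) *: w.
  have pdE : is_diff s p (0 + (fun h => 'd q s h *: w)).
    by apply: is_diffD; apply: DiffDef => //; exact: diffZl.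
  by rewrite (diff_val (is_diff_def := pdE)) -qE [LHS]add0r.
have vpd : differentiable (v \o p) s by exact: differentiable_comp.
have vpE : 'D_1 (v \o p) s =
    2 * s * \sum_i w 0 i * partial i v (x + s ^+ 2 *: w).
  rewrite deriveE// diff_comp//= pE (diff_val (is_diff_def := vd)) mulr_sumr.
  by apply: eq_bigr => i _; rewrite !mxE mulrA.
by rewrite -vpE; apply: DeriveDef => //; exact: diff_derivable.
Qed.

Lemma continuous_quadratic_path (g : 'rV[R]_n -> R) (x w : 'rV[R]_n) (s : R) :
  {for (x + s ^+ 2 *: w), continuous g} ->
  {for s, continuous (fun s : R => g (x + s ^+ 2 *: w))}.
Proof.
move=> cg; apply: continuous_comp => //.
apply: cvgD; first exact: cvg_cst.
apply: cvgZ; last exact: cvg_cst.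
exact: exprn_continuous.
Qed.
End path.

Section morrey.
Context {R : realType} (n : nat).
Local Notation T := (n.-tuple (measurableTypeR R)).
Local Notation mu := (@lebesgue_measure R).
Local Notation I01 := (`[0%R, 1%R]%classic : set (measurableTypeR R)).

(** If b <= A the summand 1 suffices. Otherwise b/A > 1, and b/A <= (b/A)^2 <= c/A^2 <= (c/A^2)^n.
    Bounding b^2 by c gives an n-th power of the majorant [q] of the squared derivatives. *)
Lemma le_interpolation (A b c : R) : (0 < n)%N -> 0 < A -> 0 <= b ->
  b ^+ 2 <= c -> b <= A * (1 + (A ^- 2 * c) ^+ n).
Proof.
move=> n0 A0 b0 bc; have A20 : 0 < A ^+ 2 by rewrite exprn_gt0.
rewrite -ler_pdivrMl// mulrC.
have c0 : 0 <= A ^- 2 * c.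
  apply: mulr_ge0; first by rewrite invr_ge0 ltW.
  by apply: le_trans bc; exact: exprn_ge0.
have [b1|b1] := leP (b / A) 1; first by rewrite (le_trans b1)// lerDl exprn_ge0.
have bb : b / A <= (b / A) ^+ 2 by rewrite expr2 ler_peMl// ltW// (lt_trans _ b1).
have bbc : (b / A) ^+ 2 <= A ^- 2 * c.
  by rewrite expr_div_n mulrC ler_pM2l// invr_gt0.
have c1 : 1 <= A ^- 2 * c by rewrite (le_trans (ltW b1))// (le_trans bb).
rewrite (le_trans bb)// (le_trans bbc)// (le_trans (ler_eXnr n0 c1))// lerDr.
exact: ler01.
Qed.

(** In the application [D] is the ball, [d] its diameter, [v] a partial derivative of [u], [q] the
    squared norm of the Hessian, and [Q] a cube inside the ball over which increments are
    averaged. *)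
Variables (D : set 'rV[R]_n) (v q : 'rV[R]_n -> R) (d : R) (Q : set T).
Hypothesis n0 : (0 < n)%N.
Hypothesis d0 : 0 <= d.
Hypothesis oD : open D.
Hypothesis convD : forall x y (s : R), D x -> D y -> 0 <= s -> s <= 1 ->
  D (x + s *: (y - x)).
Hypothesis diamD : forall x y i, D x -> D y -> `|y 0 i - x 0 i| <= d.
Hypothesis dv : forall i x, D x -> derivable v x (delta_mx 0 i).
Hypothesis cdv : forall i x, D x -> {for x, continuous (partial i v)}.
Hypothesis cq : forall x, D x -> {for x, continuous q}.
Hypothesis q0 : forall x, 0 <= q x.
Hypothesis dvq : forall i x, D x -> partial i v x ^+ 2 <= q x.
Hypothesis mQ : measurable Q.
Hypothesis QD : forall t, Q t -> D (tuple_rV t).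

(** The integral [J] of [H] is the n-th power of the L^n norm of [q] over [D]. *)
Let H : T -> R := ((fun z => q z ^+ n) \_ D) \o @tuple_rV R n.

Let mH : measurable_fun setT H.
Proof.
apply: continuous_on_open_measurable => // x Dx.
apply: (@continuous_comp _ _ _ q (fun y : R => y ^+ n)); first exact: cq.
exact: exprn_continuous.
Qed.

Let H0 t : 0 <= H t.
Proof. by rewrite /H /= patchE; case: ifP => // _; exact: exprn_ge0. Qed.

Let J := (\int[lebesgue_tuple n]_t (H t)%:E)%E.

Section one_point.
Variables (x : 'rV[R]_n) (A : R).
Hypothesis A0 : 0 < A.
Hypothesis Dx : D x.

(** The point at time s on the quadratic path from [x] to t. Writing it with [affine_tuple] makes
    it, for fixed s, a dilation by s^2 with known Jacobian. *)
Let Z (p : measurableTypeR R * T) : T :=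
  affine_tuple [tuple (1 - p.1 ^+ 2) * x 0 i | i < n] (p.1 ^+ 2) p.2.

Let ZE s t : tuple_rV (Z (s, t)) = x + s ^+ 2 *: (tuple_rV t - x).
Proof.
by apply/rowP => i; rewrite !mxE !tnth_mktuple /affine /=; ring.
Qed.

Let mZ : measurable_fun setT Z.
Proof.
apply/measurable_fun_tnthP => i.
rewrite (_ : _ \o _ = (fun p : measurableTypeR R * T =>
   (1 - p.1 ^+ 2) * x 0 i + p.1 ^+ 2 * tnth p.2 i)); last first.
  by apply/funext => p /=; rewrite !tnth_mktuple.
have mp : measurable_fun setT (fun p : measurableTypeR R * T => p.1 ^+ 2 : R).
  exact: (measurable_funX 2 measurable_fst).
apply: (@measurable_funD _ _ R).
  apply: (@measurable_funM _ _ R); last exact: measurable_cst.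
  by apply: (@measurable_funB _ _ R) => //; exact: measurable_cst.
apply: (@measurable_funM _ _ R) => //.
by apply: (measurableT_comp (measurable_tnth i)).
Qed.

(** The 2 is from the derivative of s^2, n d bounds the sum of the |w_i| for w = t - x, and A is the
    factor in [le_interpolation]. *)
Let c := 2 * (n%:R * d) * A.

Let c0 : 0 <= c. Proof. by rewrite !mulr_ge0// ltW. Qed.

Let g (p : measurableTypeR R * T) : R :=
  c * (1 + (A ^- 2 * p.1 ^+ 2) ^+ n * H (Z p)).

Let g0 p : 0 <= g p.
Proof.
rewrite /g mulr_ge0// addr_ge0// mulr_ge0// exprn_ge0// mulr_ge0 ?sqr_ge0//.
by rewrite invr_ge0 sqr_ge0.
Qed.

Let mg : measurable_fun setT g.
Proof.
apply: (@measurable_funM _ _ R); first exact: measurable_cst.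
apply: (@measurable_funD _ _ R); first exact: measurable_cst.
apply: (@measurable_funM _ _ R); last exact: measurableT_comp.
apply: (@measurable_funX _ _ R); apply: (@measurable_funM _ _ R).
  exact: measurable_cst.
exact: (measurable_funX 2 measurable_fst).
Qed.

Let G : measurableTypeR R * T -> \bar R := (EFin \o g) \_ (I01 `*` Q).

Let G0 p : (0 <= G p)%E.
Proof. by rewrite /G patchE; case: ifP => // _; rewrite lee_fin. Qed.

Let mIQ : measurable (I01 `*` Q).
Proof. by apply: measurableX => //; exact: measurable_itv. Qed.

Let mG : measurable_fun setT G.
Proof.
apply: (measurable_restrictT _ mIQ).1.
by apply: measurable_funTS; exact/measurable_EFinP.
Qed.

(** The derivative along the path is 2 times the sum of w_i times s times the i-th partial
    derivative of [v]; each |w_i| is at most [d], and the factor s stays with the partial derivative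
    for [le_interpolation]. *)
Lemma increment_le_integral t : Q t ->
  (`|v (tuple_rV t) - v x|%:E <= \int[mu]_s G (s, t))%E.
Proof.
move=> Qt.
pose w := tuple_rV t - x.
have xw : x + w = tuple_rV t by rewrite /w addrC subrK.
pose df s := 2 * s * \sum_i w 0 i * partial i v (x + s ^+ 2 *: w).
have D01 (s : R) : s \in `[0, 1] -> D (x + s ^+ 2 *: w).
  rewrite in_itv/= => /andP[s0 s1]; apply: convD => //; first exact: QD.
    exact: sqr_ge0.
  exact: exprn_ile1.
have := @abs_increment_le_integral R
  (fun s => v (x + s ^+ 2 *: w)) df (fun s => g (s, t)).
rewrite expr1n scale1r expr0n scale0r addr0 xw => /(_ _ _ _ _)/le_trans.
apply.
- by move=> s /D01; exact: is_derive_quadratic_path.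
- apply: continuous_in_subspaceT => s /set_mem s01.
  apply: cvgM; first by apply: cvgM; [exact: cvg_cst|exact: cvg_id].
  apply: (cvg_sum (nbhs_filter s)) => i; apply: cvgM; first exact: cvg_cst.
  by apply: continuous_quadratic_path; apply: cdv; exact: D01.
- by apply: measurable_funTS; exact: (measurableT_comp mg (pair2_measurable t)).
- move=> s s01; have Dz := D01 s s01; rewrite /df /g /= /H/= ZE -/w patchE mem_set//.
  have [s0 s1] : 0 <= s /\ s <= 1 by move: s01; rewrite in_itv => /andP[].
  set z := x + _ in Dz *.
  have -> : (A ^- 2 * s ^+ 2) ^+ n * q z ^+ n = (A ^- 2 * (s ^+ 2 * q z)) ^+ n.
    by rewrite [in RHS]mulrA [in RHS]exprMn.
  have B i : `|s * partial i v z| <= A * (1 + (A ^- 2 * (s ^+ 2 * q z)) ^+ n).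
    apply: le_interpolation => //.
    by rewrite real_normK ?num_real// exprMn ler_wpM2l ?sqr_ge0// dvq.
  set X := (_ ^+ n) in B *; have -> : c * (1 + X) = 2 * (n%:R * (d * (A * (1 + X)))).
    by rewrite /c; ring.
  rewrite -[2 * s * _]mulrA normrM ger0_norm// ler_wpM2l//.
  rewrite mulr_sumr (le_trans (ler_norm_sum _ _ _))//.
  (* The factor n becomes a sum of n equal terms, compared coordinate by coordinate. *)
  rewrite mulr_natl -[X in _ *+ X]card_ord -sumr_const ler_sum// => i _.
  rewrite mulrCA normrM ler_pM//.
  by rewrite /w; have := @diamD x (tuple_rV t) i Dx (QD Qt); rewrite !mxE.
- rewrite integral_mkcond le_eqVlt; apply/orP; left; apply/eqP.
  apply: eq_integral => s _; rewrite /G !patchE.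
  by rewrite in_setX (mem_set Qt) andbT.
Qed.

(** By Tonelli, t is integrated first, at fixed s. The substitution z = [Z (s, t)] has Jacobian
    (s^2)^n, which cancels that power of s in [g]; the resulting bound does not depend on s, and s
    ranges over an interval of length 1. *)
Lemma integral_increment_bound :
  (\int[lebesgue_tuple n]_t \int[mu]_s G (s, t) <=
   c%:E * lebesgue_tuple n Q + (c * A ^- 2 ^+ n)%:E * J)%E.
Proof.
rewrite -fubini_tonelli//.
have J0 : (0 <= J)%E by apply: integral_ge0 => t _; rewrite lee_fin.
have cA0 : 0 <= c * A ^- 2 ^+ n.
  by rewrite mulr_ge0// exprn_ge0// invr_ge0 exprn_ge0// ltW.
have K0 : (0 <= c%:E * lebesgue_tuple n Q + (c * A ^- 2 ^+ n)%:E * J)%E.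
  by rewrite adde_ge0// mule_ge0// lee_fin.
set K := (_ + _)%E in K0 *.
have mI01 : measurable I01 by exact: measurable_itv.
apply: (@le_trans _ _ (\int[mu]_s ((cst K \_ I01) s)))%E; last first.
  have muI : mu I01 = 1%E.
    by have := lebesgue_measure_itv `[0:R, 1:R]; rewrite /= lte_fin ltr01 sube0.
  rewrite -integral_mkcond integral_cst//.
  by rewrite [X in (_ * X)%E](_ : _ = 1%E) ?mule1.
apply: ge0_le_integral => //.
- by move=> s _; exact: integral_ge0.
- exact: (measurable_fun_fubini_tonelli_F (m2 := lebesgue_tuple n) _ mG G0).
- by apply: (measurable_restrictT _ mI01).1; exact: measurable_cst.
move=> s _; rewrite patchE; case: ifPn => [sI|sI]; last first.
  rewrite integral0_eq// => t _.
  by rewrite /G patchE in_setX (negbTE sI).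
pose k := c * (A ^- 2 * s ^+ 2) ^+ n.
have k0 : 0 <= k.
  by rewrite mulr_ge0// exprn_ge0// mulr_ge0 ?sqr_ge0// invr_ge0 sqr_ge0.
have mHZ : measurable_fun setT (fun t => H (Z (s, t))).
  by apply: (measurableT_comp mH); apply: (measurableT_comp mZ).
(* The indicator of [Q] is kept on the constant term only; the other term is enlarged to the whole
   space, ready for the substitution. *)
apply: (@le_trans _ _ (\int[lebesgue_tuple n]_t
    (c%:E * (\1_Q t)%:E + k%:E * (H (Z (s, t)))%:E))%E).
  apply: ge0_le_integral => //.
  - exact: (measurableT_comp mG (pair1_measurable s)).
  - apply: emeasurable_funD; apply: emeasurable_funM; try exact: measurable_cst.
      by apply/measurable_EFinP; exact: measurable_indic.
    exact/measurable_EFinP.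
  move=> t _; rewrite /G patchE in_setX sI /= indicE.
  case: ifPn => tQ; last by rewrite mule0 add0e mule_ge0// lee_fin.
  by rewrite mule1 -EFinM -EFinD lee_fin /g /k /= mulrDr mulr1 mulrA.
rewrite ge0_integralD//; last 4 first.
- by move=> t _; rewrite mule_ge0// lee_fin.
- apply: emeasurable_funM; first exact: measurable_cst.
  by apply/measurable_EFinP; exact: measurable_indic.
- by move=> t _; rewrite mule_ge0// lee_fin.
- apply: emeasurable_funM; first exact: measurable_cst.
  exact/measurable_EFinP.
rewrite !ge0_integralZl//; last 3 first.
- exact/measurable_EFinP.
- by move=> t _; rewrite lee_fin.
- by apply/measurable_EFinP; exact: measurable_indic.
rewrite integral_indic// setIT; apply: leeD => //.
(* At s = 0 the dilation degenerates, but there k = 0 since n > 0. *)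
rewrite /k; have [->|s0] := eqVneq s 0.
  rewrite expr0n mulr0 expr0n eqn0Ngt n0 mulr0 mul0e.
  by rewrite mule_ge0// lee_fin.
have s20 : 0 < s ^+ 2 by rewrite exprn_even_gt0//= s0 orbT.
rewrite /J -(@ge0_integral_affine_tuple _ _ [tuple (1 - s ^+ 2) * x 0 i | i < n] _
  (fun t => (H t)%:E) s20)//; last exact/measurable_EFinP.
by rewrite muleA -EFinM exprMn mulrA.
Qed.

(** This hides the path: [oscillation_le] needs only a measurable majorant with a bounded integral,
    once for each of its two base points. *)
Lemma increment_majorant : exists F : T -> \bar R,
  [/\ measurable_fun setT F, forall t, (0 <= F t)%E,
    forall t, Q t -> (`|v (tuple_rV t) - v x|%:E <= F t)%E &
    (\int[lebesgue_tuple n]_t F t <=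
     c%:E * lebesgue_tuple n Q + (c * A ^- 2 ^+ n)%:E * J)%E].
Proof.
exists (fun t => \int[mu]_s G (s, t))%E; split.
- exact: (measurable_fun_fubini_tonelli_G (m1 := mu) _ mG G0).
- by move=> t; exact: integral_ge0.
- exact: increment_le_integral.
- exact: integral_increment_bound.
Qed.

End one_point.

(** Integrate |v x - v y| <= |v t - v x| + |v t - v y| over t in [Q]. The condition on [J] makes the
    second term of each bound at most the first, so the total is at most 4c times the measure of
    [Q], by which one divides. *)
Lemma oscillation_le x y A : 0 < A -> D x -> D y ->
  (0 < lebesgue_tuple n Q < +oo)%E ->
  (J <= ((A ^+ 2) ^+ n)%:E * lebesgue_tuple n Q)%E ->
  `|v x - v y| <= 8 * (n%:R * d) * A.
Proof.
move=> A0 Dx Dy /andP[Q0 Qoo] JA.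
have [Fx [mFx Fx0 xF iFx]] := increment_majorant A0 Dx.
have [Fy [mFy Fy0 yF iFy]] := increment_majorant A0 Dy.
have Qfin : lebesgue_tuple n Q \is a fin_num by rewrite ge0_fin_numE.
set c := 2 * (n%:R * d) * A in iFx iFy.
have c0 : 0 <= c by rewrite !mulr_ge0// ltW.
have A20 : 0 < A ^+ 2 by rewrite exprn_gt0.
have cJ : ((c * A ^- 2 ^+ n)%:E * J <= c%:E * lebesgue_tuple n Q)%E.
  apply: le_trans (lee_wpmul2l _ JA) _.
    by rewrite lee_fin mulr_ge0// exprn_ge0// invr_ge0 ltW.
  by rewrite muleA -EFinM -mulrA -exprMn mulVf ?gt_eqF// expr1n mulr1.
have : (`|v x - v y|%:E * lebesgue_tuple n Q <=
    (8 * (n%:R * d) * A)%:E * lebesgue_tuple n Q)%E.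
  rewrite -integral_cst// integral_mkcond.
  apply: (@le_trans _ _ (\int[lebesgue_tuple n]_t (Fx t + Fy t))%E).
    apply: ge0_le_integral => //.
    - by move=> t _; rewrite patchE; case: ifP => // _; rewrite lee_fin.
    - by apply: (measurable_restrictT _ mQ).1; exact: measurable_cst.
    - exact: emeasurable_funD.
    move=> t _; rewrite patchE; case: ifPn => [/set_mem Qt|_]; last exact: adde_ge0.
    apply: le_trans (leeD (xF t Qt) (yF t Qt)); rewrite -EFinD lee_fin.
    by rewrite [X in _ <= X + _]distrC; exact: ler_distD.
  rewrite ge0_integralD//.
  apply: le_trans (leeD (le_trans iFx (leeD2l _ cJ)) (le_trans iFy (leeD2l _ cJ))) _.
  rewrite -(fineK Qfin) -!EFinM -!EFinD lee_fin /c le_eqVlt; apply/orP; left.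
  by apply/eqP; ring.
by rewrite lee_pmul2r// lee_fin.
Qed.
End morrey.

(** * Balls and critical points *)

Section ball.
Context {R : realType} (n : nat).
Implicit Types (x y : 'rV[R]_n) (u : 'rV[R]_n -> R).

Lemma enorm_ltE x r : 0 < r -> (enorm x < r) = (\sum_(i < n) x 0 i ^+ 2 < r ^+ 2).
Proof.
move=> r0; rewrite /enorm -{1}(ger0_norm (ltW r0)) -sqrtr_sqr ltr_sqrt//.
by rewrite exprn_gt0.
Qed.

Lemma le_coord_enorm x i : `|x 0 i| <= enorm x.
Proof.
rewrite -sqrtr_sqr ler_sqrt ?sumr_ge0// => [|j _]; last exact: sqr_ge0.
by rewrite (bigD1 i)//= lerDl sumr_ge0// => j _; exact: sqr_ge0.
Qed.

Lemma continuous_enorm : continuous (@enorm R n).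
Proof.
move=> x.
apply: (@continuous_comp _ _ _
  (fun x : 'rV[R]_n => \sum_i x 0 i ^+ 2) Num.sqrt).
  apply: (cvg_sum (nbhs_filter x)) => i.
  by apply: (@continuous_comp _ _ _ (fun x : 'rV[R]_n => x 0 i) (fun t : R => t ^+ 2));
    [exact: coord_continuous|exact: exprn_continuous].
exact: sqrt_continuous.
Qed.

Let continuous_enormB x0 : continuous (fun x => enorm (x - x0)).
Proof.
move=> x; apply: (@continuous_comp _ _ _ (fun x : 'rV[R]_n => x - x0) (@enorm R n)).
  by apply: (cvgB (FF := nbhs_filter x)); [exact: cvg_id|exact: cvg_cst].
exact: continuous_enorm.
Qed.

Lemma open_eball x0 r : open (eball x0 r).
Proof.
apply: (@open_comp _ _ (fun x => enorm (x - x0)) [set t | t < r]).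
  by move=> x _; exact: continuous_enormB.
exact: open_lt.
Qed.

Lemma eball_segment x0 r x y (s : R) : 0 < r -> eball x0 r x -> eball x0 r y ->
  0 <= s -> s <= 1 -> eball x0 r (x + s *: (y - x)).
Proof.
move=> r0; rewrite /eball /= !enorm_ltE// => xr yr s0 s1.
(* For s > 0 the strict inequality comes from the term weighted by s, so s = 0 is separate. *)
have [->|sn0] := eqVneq s 0; first by rewrite scale0r addr0.
have {sn0}s0 : 0 < s by rewrite lt0r sn0.
apply: (@le_lt_trans _ _ ((1 - s) * (\sum_i (x - x0) 0 i ^+ 2) +
    s * (\sum_i (y - x0) 0 i ^+ 2))).
  rewrite !mulr_sumr -big_split; apply: ler_sum => i _; rewrite !mxE /=.
  set a := x 0 i; set b := y 0 i; set e := x0 0 i.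
  (* Convexity of the square, as an exact identity. *)
  rewrite -subr_ge0 (_ : _ - _ = s * (1 - s) * (b - a) ^+ 2); last by ring.
  apply: mulr_ge0; last exact: sqr_ge0.
  by apply: mulr_ge0; [exact: ltW|rewrite subr_ge0].
rewrite [X in _ < X](_ : r ^+ 2 = (1 - s) * r ^+ 2 + s * r ^+ 2); last by ring.
by apply: ler_ltD; [rewrite ler_wpM2l ?subr_ge0// ltW|rewrite ltr_pM2l].
Qed.

Lemma eball_coord_diam x0 r x y i : eball x0 r x -> eball x0 r y ->
  `|y 0 i - x 0 i| <= 2 * r.
Proof.
move=> xr yr.
rewrite (_ : _ - _ = (y - x0) 0 i - (x - x0) 0 i); last by rewrite !mxE; ring.
rewrite mulrDl mul1r (le_trans (ler_normB _ _))// lerD//.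
  by apply: le_trans (le_coord_enorm _ _) (ltW yr).
by apply: le_trans (le_coord_enorm _ _) (ltW xr).
Qed.

Lemma compact_closed_eball x0 r : 0 <= r -> compact [set x | enorm (x - x0) <= r].
Proof.
move=> r0; apply: bounded_closed_compact.
  exists (`|x0| + r); split; first exact: num_real.
  move=> M /ltW rM x /= xr; apply: le_trans rM.
  rewrite -(subrK x0 x) addrC (le_trans (ler_normD _ _))// lerD2l.
  apply: norm_le_coord => // i; exact: le_trans (le_coord_enorm _ _) xr.
apply: (@preimage_closed _ _ (fun x : 'rV[R]_n => enorm (x - x0)) [set t | t <= r]).
  by move=> x _; exact: continuous_enormB.
exact: closed_le.
Qed.

(** Fermat's rule for the restriction of [u] to the line through [x] in direction i, which stays in
    [D] near [x]. *)
Lemma partial_local_max (D : set 'rV[R]_n) u x i : open D ->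
  (forall y, D y -> derivable u y (delta_mx 0 i)) -> D x ->
  (forall y, D y -> u y <= u x) -> partial i u x = 0.
Proof.
move=> oD du Dx umax; pose e : 'rV[R]_n := delta_mx 0 i.
pose f (h : R) := u (x + h *: e).
have : \forall h \near (0 : R), D (x + h *: e).
  have : {for 0, continuous (fun h : R => x + h *: e)}.
    apply: cvgD; first exact: cvg_cst.
    by apply: cvgZ; [exact: cvg_id|exact: cvg_cst].
  apply; rewrite scale0r addr0; exact: open_nbhs_nbhs.
move=> /nbhs_ballP[d /= d0 dD].
have dDD (h : R) : h \in `](- d), d[ -> D (x + h *: e).
  rewrite in_itv/= => /andP[h1 h2]; apply: dD.
  by rewrite -ball_normE/= sub0r normrN ltr_norml h1.
have df (h : R) : h \in `](- d), d[ -> is_derive h 1 f ('D_e u (x + h *: e)).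
  by move=> hd; apply: is_derive_line; apply: du; exact: dDD.
have d00 : 0 \in `](- d), d[ by rewrite in_itv/= oppr_lt0 d0.
have f0 : is_derive (0 : R) 1 f 0.
  apply: (@derive1_at_max _ f (- d) d) => //.
  - by rewrite ge0_cp// ltW.
  - by move=> h /df[].
  - by move=> h hd; rewrite /f scale0r addr0; apply: umax; exact: dDD.
have := @derive_val _ _ _ _ _ _ _ (df 0 d00).
by rewrite derive_val scale0r addr0.
Qed.

End ball.

Section critical_point.
Context {R : realType} (n : nat).

(** As in Rolle's theorem: [u] has a maximum and a minimum on the compact closed ball, and an
    extremum in the open ball is critical. *)
Lemma exists_critical_point (x0 : 'rV[R]_n) (r : R) (u : 'rV[R]_n -> R) :
  0 < r ->
  (forall i y, eball x0 r y -> derivable u y (delta_mx 0 i)) ->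
  {within [set x | enorm (x - x0) <= r], continuous u} ->
  (forall x, enorm (x - x0) = r -> u x = 0) ->
  exists2 x, eball x0 r x & forall i, partial i u x = 0.
Proof.
move=> r0 du cu ur.
have oB := @open_eball R n x0 r.
have ball_closed y : eball x0 r y -> y \in [set x | enorm (x - x0) <= r].
  by move=> yr; apply/mem_set; exact: ltW.
have x0r : eball x0 r x0.
  by rewrite /eball /= enorm_ltE// big1 ?exprn_gt0// => i _; rewrite !mxE subrr expr0n.
have B0 : [set x | enorm (x - x0) <= r] !=set0 by exists x0; exact: ltW.
have cB := @compact_closed_eball R n x0 r (ltW r0).
have [a /set_mem /= aB amax] := compact_EVT_max B0 cB cu.
have [b /set_mem /= bB bmin] := compact_EVT_min B0 cB cu.
have max_critical x : eball x0 r x ->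
    (forall y, eball x0 r y -> u y <= u x) -> forall i, partial i u x = 0.
  by move=> xr xmax i; apply: (partial_local_max oB) xr xmax; exact: du.
have [ar|ar] := boolP (enorm (a - x0) < r).
  exists a => //; apply: max_critical => // y /ball_closed; exact: amax.
have [br|br] := boolP (enorm (b - x0) < r).
  exists b => // i.
  have : partial i (- u) b = 0.
    apply: (partial_local_max oB) br _ => y yr; first exact/derivableN/du.
    by rewrite lerN2; apply: bmin; exact: ball_closed.
  by rewrite /partial deriveN; [move/eqP; rewrite oppr_eq0 => /eqP|exact: du].
have u0 z : enorm (z - x0) <= r -> ~~ (enorm (z - x0) < r) -> u z = 0.
  by move=> zr; rewrite -leNgt => rz; apply: ur; apply/eqP; rewrite eq_le zr.
(* Both extrema lie on the sphere, so [u] vanishes on the ball and the centre will do. *)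
exists x0 => //; apply: max_critical => // y yr.
have ux0 : u x0 = 0.
  apply/eqP; rewrite eq_le -{1}(u0 _ aB ar) -(u0 _ bB br).
  by rewrite amax ?bmin//; exact: ball_closed.
by rewrite ux0 -(u0 _ aB ar); apply: amax; exact: ball_closed.
Qed.

Lemma lebesgue_tuple_cube (x0 : 'rV[R]_n) (a : R) : 0 <= a ->
  lebesgue_tuple n [set t | forall i, `[x0 0 i - a, x0 0 i + a]%classic (tnth t i)] =
  ((2 * a) ^+ n)%:E.
Proof.
move=> a0.
rewrite (@lebesgue_tuple_box R n
  (fun i => `[x0 0 i - a, x0 0 i + a]%classic)); last first.
  by move=> i; exact: measurable_itv.
rewrite (eq_bigr (fun=> (2 * a)%:E)) => [|i _]; last first.
  have := lebesgue_measure_itv `[x0 0 i - a, x0 0 i + a] => /= ->.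
  rewrite lte_fin -subr_gt0 (_ : _ - _ = 2 * a); last by ring.
  case: ifPn => [_|]; first by rewrite -EFinB; congr EFin; ring.
  rewrite -leNgt => a0'; congr EFin; apply/eqP.
  by rewrite eq_sym eq_le a0' mulr_ge0.
by rewrite prodEFin prodr_const card_ord.
Qed.

End critical_point.

(** * The gradient estimate *)

Section gradient.
Context {R : realType} (n : nat).

(** Extending by zero commutes with the n-th power because n > 0. The integral on the right is the
    [J] of Morrey's inequality. *)
Lemma LpnormOn_natE (D : set 'rV[R]_n) (g : 'rV[R]_n -> R) : (0 < n)%N ->
  (forall x, 0 <= g x) ->
  LpnormOn n%:R%:E D g =
  ((\int[lebesgue_tuple n]_t (((fun z => g z ^+ n) \_ D) (tuple_rV t))%:E)
     `^ n%:R^-1)%E.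
Proof.
move=> n0 g0; rewrite /LpnormOn Lnorm.unlock /=; congr (_ `^ _)%E.
apply: eq_integral => t _; rewrite /= !patchE; case: ifPn => _.
  by rewrite ger0_norm// powR_mulrn.
by rewrite normr0 powR0 ?pnatr_eq0 -?lt0n.
Qed.

(** Apply [oscillation_le] to each partial derivative between [x] and a critical point, then sum the
    n squares; this last sum turns n^3 into n^4. *)
Lemma grad_sq_le (x0 : 'rV[R]_n) (r : R) (u : 'rV[R]_n -> R) x :
  (0 < n)%N -> 0 < r -> smooth (eball x0 r) u ->
  {within [set x | enorm (x - x0) <= r], continuous u} ->
  (forall x, enorm (x - x0) = r -> u x = 0) ->
  eball x0 r x ->
  ((grad_sq u x)%:E <= (256 * n%:R ^+ 4)%:E *
     (r%:E * LpnormOn n%:R%:E (eball x0 r) (hess_sq u)))%E.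
Proof.
move=> n0 r0 su cu ur xr; set D := eball x0 r in su xr *.
have n0' : (0 : R) < n%:R by rewrite ltr0n.
have oD : open D := @open_eball R n x0 r.
have [_ d1] := su 2.
have du i y : D y -> derivable u y (delta_mx 0 i) by have [+ _] := d1 i; exact.
have [y yr yc] := exists_critical_point r0 du cu ur.
have h0 z : 0 <= hess_sq u z.
  by apply: sumr_ge0 => i _; apply: sumr_ge0 => j _; exact: sqr_ge0.
have dv i j z : D z -> derivable (partial i u) z (delta_mx 0 j).
  by have [_ [_ d2]] := d1 i; have [+ _] := d2 j; exact.
have cdv i j z : D z -> {for z, continuous (partial j (partial i u))}.
  by have [_ [_ d2]] := d1 i; have [_ [+ _]] := d2 j; exact.
have ch z : D z -> {for z, continuous (hess_sq u)}.
  move=> Dz; apply: (cvg_sum (nbhs_filter z)) => i.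
  apply: (cvg_sum (nbhs_filter z)) => j.
  apply: (@continuous_comp _ _ _ (partial j (partial i u)) (fun t : R => t ^+ 2)).
    exact: cdv.
  exact: exprn_continuous.
have dvh i j z : D z -> partial j (partial i u) z ^+ 2 <= hess_sq u z.
  move=> _; apply: (@le_trans _ _ (\sum_k partial k (partial i u) z ^+ 2)).
    by rewrite (bigD1 j)//= lerDl; apply: sumr_ge0 => k _; exact: sqr_ge0.
  rewrite /hess_sq [leRHS](bigD1 i)//= lerDl.
  by apply: sumr_ge0 => k _; apply: sumr_ge0 => l _; exact: sqr_ge0.
rewrite LpnormOn_natE//.
set J := (\int[_]_t _)%E.
have J0 : (0 <= J)%E.
  apply: integral_ge0 => t _; rewrite lee_fin patchE.
  by case: ifP => // _; exact: exprn_ge0.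
have ninv0 : (n%:R^-1 : R) != 0 by rewrite invr_eq0 gt_eqF.
have C0 : 0 < 256 * n%:R ^+ 4 :> R by rewrite mulr_gt0// exprn_gt0.
have [Joo|Jfin] := eqVneq J +oo%E.
  by rewrite Joo poweRyr// gt0_muley ?lte_fin// gt0_muley ?lte_fin// leey.
have {}Jfin : J \is a fin_num by rewrite ge0_fin_numE// ltey.
rewrite -(fineK Jfin) poweR_EFin -!EFinM lee_fin.
set m := fine J `^ n%:R^-1.
have m0 : 0 <= m by exact: powR_ge0.
have mn : m ^+ n = fine J.
  rewrite /m -powR_mulrn ?powR_ge0// -powRrM mulVf ?gt_eqF// powRr1//.
  exact: fine_ge0.
(* The cube has side r/n, hence volume (r/n)^n, and lies in the ball since n a^2 = r^2/(4n) <
   r^2. *)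
pose a := r / (2 * n%:R).
have a0 : 0 < a by rewrite divr_gt0// mulr_gt0.
pose Q := [set t : n.-tuple (measurableTypeR R) |
  forall i, `[x0 0 i - a, x0 0 i + a]%classic (tnth t i)].
have QE : lebesgue_tuple n Q = ((r / n%:R) ^+ n)%:E.
  rewrite lebesgue_tuple_cube ?ltW//; congr (_ ^+ _)%:E.
  by rewrite /a; field; rewrite gt_eqF.
have QD t : Q t -> D (tuple_rV t).
  move=> Qt; rewrite /D /eball /= enorm_ltE//.
  apply: (@le_lt_trans _ _ (n%:R * a ^+ 2)).
    rewrite mulr_natl -[X in _ *+ X]card_ord -sumr_const ler_sum// => i _.
    have ai : `|tnth t i - x0 0 i| <= a.
      by rewrite ler_distl; have := Qt i; rewrite /= in_itv/=.
    rewrite !mxE -(real_normK (num_real (_ - _))).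
    by apply: lerXn2r ai; rewrite nnegrE// ltW.
  rewrite /a expr_div_n mulrA ltr_pdivrMr ?exprn_gt0 ?mulr_gt0//.
  rewrite mulrC ltr_pM2l ?exprn_gt0//.
  have n1 : 1 <= n%:R :> R by rewrite ler1n.
  by nra.
have osc i e : 0 < e ->
    partial i u x ^+ 2 <= 256 * n%:R ^+ 3 * (r * m) + 256 * (n%:R * r) ^+ 2 * e.
  (* The value m n / r gives equality in J <= (A^2)^n |Q|, since J = m^n. Adding [e] keeps A
     positive even if m = 0. Squaring 8 n (2r) A then produces the constant 256. *)
  move=> e0; pose A2 := m * n%:R / r + e.
  have A20 : 0 < A2 by rewrite ltr_wpDl// !mulr_ge0// ?invr_ge0 ltW.
  pose A := Num.sqrt A2.
  have AE : A ^+ 2 = A2 by rewrite sqr_sqrtr// ltW.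
  have nr0 : 0 < n%:R * (2 * r) by rewrite !mulr_gt0.
  have osc : `|partial i u x - partial i u y| <= 8 * (n%:R * (2 * r)) * A.
    apply: (@oscillation_le R n D (partial i u) (hess_sq u) (2 * r) Q) => //.
    - by rewrite mulr_ge0// ltW.
    - by move=> ? ? ?; exact: (eball_segment r0).
    - by move=> ? ? ?; exact: eball_coord_diam.
    - exact: dv.
    - exact: cdv.
    - exact: dvh.
    - apply: (@measurable_box R n (fun k => `[x0 0 k - a, x0 0 k + a]%classic)) => k.
      exact: measurable_itv.
    - by rewrite sqrtr_gt0.
    - by rewrite QE lte_fin ltry exprn_gt0// divr_gt0.
    rewrite -[leLHS]/J -(fineK Jfin) QE -EFinM lee_fin AE -mn -exprMn.
    have -> : A2 * (r / n%:R) = m + e * (r / n%:R).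
      by rewrite /A2; field; rewrite !gt_eqF.
    have er0 : 0 <= e * (r / n%:R) by rewrite mulr_ge0 ?divr_ge0// ltW.
    by apply: lerXn2r; rewrite ?nnegrE ?addr_ge0// lerDl.
  rewrite yc subr0 in osc.
  have -> : 256 * n%:R ^+ 3 * (r * m) + 256 * (n%:R * r) ^+ 2 * e =
      (8 * (n%:R * (2 * r)) * A) ^+ 2.
    by rewrite [in RHS]exprMn AE /A2; field; rewrite gt_eqF.
  rewrite -(real_normK (num_real (partial i u x))).
  by apply: lerXn2r osc; rewrite nnegrE// !mulr_ge0 ?sqrtr_ge0// ltW.
(* Let [e] tend to 0, rescaled by its coefficient. *)
have {}osc i : partial i u x ^+ 2 <= 256 * n%:R ^+ 3 * (r * m).
  apply/ler_addgt0Pr => e e0.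
  have k0 : 0 < 256 * (n%:R * r) ^+ 2 by rewrite mulr_gt0// exprn_gt0// mulr_gt0.
  have := osc i (e / (256 * (n%:R * r) ^+ 2)) (divr_gt0 e0 k0).
  by rewrite [X in _ + X]mulrC divfK// gt_eqF.
apply: (@le_trans _ _ (\sum_(i < n) 256 * n%:R ^+ 3 * (r * m))).
  by apply: ler_sum => i _; exact: osc.
rewrite sumr_const card_ord -mulr_natr le_eqVlt; apply/orP; left.
by apply/eqP; ring.
Qed.

End gradient.

Theorem theorem2p8 (R : realType) (n : nat) (n_gt0 : (0 < n)%N) :
  exists C : \bar R -> R, (forall K, 0 < C K) /\
    forall (x0 : 'rV[R]_n) (r : R) (f : R -> R) (u : 'rV[R]_n -> R),
      0 < r ->
      C1 f ->
      smooth (eball x0 r) u ->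
      {within [set x | enorm (x - x0) <= r], continuous u} ->
      (forall x, eball x0 r x -> laplacian u x = f (u x)) ->
      (forall x, enorm (x - x0) = r -> u x = 0) ->
      (forall x, r < enorm (x - x0) -> u x = 0) ->
      (ereal_sup [set (grad_sq u x)%:E | x in eball x0 r] <=
       (C ((r ^+ 2)%:E * LpnormOn +oo (eball x0 r) (derive1 f \o u))%E)%:E *
       (((n%:R ^+ 2 * fine (vol (eball (0 : 'rV[R]_n) 1)) `^ (2 / n%:R))^-1)%:E *
          LpnormOn n%:R%:E (eball x0 r) (f \o u) ^+ 2
        + r%:E * LpnormOn n%:R%:E (eball x0 r) (hess_sq u)))%E.
Proof.
exists (fun=> 256 * n%:R ^+ 4); split.
  by move=> _; rewrite mulr_gt0// exprn_gt0// ltr0n.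
move=> x0 r f u r0 _ su cu _ ur _.
apply: ge_ereal_sup => _ [x xr <-].
apply: le_trans (grad_sq_le n_gt0 r0 su cu ur xr) _.
apply: lee_wpmul2l; first by rewrite lee_fin mulr_ge0.
(* The summand with [f \o u] is nonnegative, so adding it to the Hessian term only enlarges the
   bound. *)
rewrite leeDr// mule_ge0//.
  by rewrite lee_fin invr_ge0 mulr_ge0// powR_ge0.
by rewrite expe_ge0// Lnorm_ge0.
Qed.
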